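(* Let $(V,Y,\mathbf 1,\omega)$ be a vertex operator algebra. For $v\in V$ define $X(v,x)=Y(x^{L(0)}v,x)$ (so $X(v,x)=x^{\mathrm{wt}\,v}Y(v,x)$ for homogeneous $v$), and for $u\in V$ define Zhu's operator $Y[u,y]=Y(e^{yL(0)}u,\,e^{y}-1)$. Let $\delta(x)=\sum_{n\in\mathbb Z}x^n$ and let $$y_{21}=\log\Big(1-\frac{x_2}{x_1}\Big),\quad y_{12}=\log\Big(1-\frac{x_1}{x_2}\Big),\quad y_{01}=\log\Big(1-\frac{x_0}{x_1}\Big),$$ each understood as the formal series $\log(1-z)=-\sum_{k\ge1}z^k/k$. Then for all $u,v\in V$, $$x_0^{-1}\delta\Big(e^{y_{21}}\frac{x_1}{x_0}\Big)X(u,x_1)X(v,x_2)-x_0^{-1}\delta\Big(-e^{y_{12}}\frac{x_2}{x_0}\Big)X(v,x_2)X(u,x_1)=x_2^{-1}\delta\Big(e^{y_{01}}\frac{x_1}{x_2}\Big)X\big(Y[u,-y_{01}]v,\,x_2\big).$$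
   Context: A vertex operator algebra $(V,Y,\mathbf 1,\omega)$ over $\mathbb C$ is a $\mathbb Z$-graded vector space $V=\coprod_{n\in\mathbb Z}V_{(n)}$ (for $v\in V_{(n)}$, $\mathrm{wt}\,v=n$) with $\dim V_{(n)}<\infty$ and $V_{(n)}=0$ for $n$ sufficiently small, equipped with a linear map $v\mapsto Y(v,x)=\sum_{n\in\mathbb Z}v_nx^{-n-1}\in(\mathrm{End}\,V)[[x,x^{-1}]]$ and vectors $\mathbf 1\in V_{(0)}$, $\omega\in V_{(2)}$, such that for $u,v\in V$: $u_nv=0$ for $n$ sufficiently large; $Y(\mathbf 1,x)=1$; $Y(v,x)\mathbf 1\in V[[x]]$ with constant term $v$; the Jacobi identity $x_0^{-1}\delta\big(\frac{x_1-x_2}{x_0}\big)Y(u,x_1)Y(v,x_2)-x_0^{-1}\delta\big(\frac{x_2-x_1}{-x_0}\big)Y(v,x_2)Y(u,x_1)=x_2^{-1}\delta\big(\frac{x_1-x_0}{x_2}\big)Y(Y(u,x_0)v,x_2)$ holds, where binomial expressions are expanded in nonnegative powers of the second variable; writing $Y(\omega,x)=\sum_n L(n)x^{-n-2}$, the operators $L(n)$ satisfy $[L(m),L(n)]=(m-n)L(m+n)+\frac1{12}(m^3-m)\delta_{m+n,0}c$ for a constant $c\in\mathbb C$ (the rank); $L(0)v=(\mathrm{wt}\,v)v$ for homogeneous $v$; and $\frac{d}{dx}Y(v,x)=Y(L(-1)v,x)$. Here all variables $x_0,x_1,x_2,y$ are commuting formal variables; $e^{y}$ and $e^{yL(0)}$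 are formal exponential series; $Y(\cdot,x_2)$ and $X(\cdot,x_2)$ are extended linearly to formal series with coefficients in $V$; and expressions such as $e^{y_{21}}$, $e^{-y_{01}}$ are the corresponding formal series (e.g. $e^{y_{21}}=1-x_2/x_1$). *)

(* Defs.v *)
From mathcomp Require Import all_boot all_algebra.
From mathcomp Require Import boolp classical_sets fsbigop.
Set Implicit Arguments. Unset Strict Implicit. Unset Printing Implicit Defensive.
Import GRing.Theory.
Local Open Scope ring_scope.

(* Finitely supported sums: [fsum f] is the sum of all the (finitely many)   *)
(* nonzero values of f.  All sums used below are finite in the situations of *)
(* the theorem (this is the usual well-definedness of formal calculus).     *)
Definition fsum {I : choiceType} {A : nmodType} (f : I -> A) : A :=
  \sum_(i \in [set: I]) f i.

Section FormalSeries.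
Variable C : numClosedFieldType.

(* A series sum_i f i t^i is given by its coefficient function f : int -> C. *)
Definition ser1 := int -> C.

Definition lower_bounded1 (f : ser1) : Prop := exists N : int, forall i, i < N -> f i = 0.

Definition one1 : ser1 := fun i => (i == 0)%:R.
Definition var1 : ser1 := fun i => (i == 1)%:R.
Definition add1 (f g : ser1) : ser1 := fun i => f i + g i.
Definition opp1 (f : ser1) : ser1 := fun i => - f i.
Definition mul1 (f g : ser1) : ser1 := fun i => fsum (fun k : int => f k * g (i - k)).
Definition pow1 (f : ser1) (n : nat) : ser1 := iter n (mul1 f) one1.
Definition inv1 (f : ser1) : ser1 :=
  match pselect (exists g : ser1, lower_bounded1 g /\ mul1 f g = one1) with
  | left H => projT1 (cid H)
  | right _ => fun _ => 0
  end.
Definition powz1 (f : ser1) (n : int) : ser1 :=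
  match n with Posz k => pow1 f k | Negz k => pow1 (inv1 f) k.+1 end.
Definition exp1 (g : ser1) : ser1 :=
  fun i => fsum (fun n : nat => pow1 g n i / (n`!)%:R).
Definition log1m : ser1 := fun i => if 0 < i then - (i%:~R)^-1 else 0.

(* A series with coefficients in A is a function T3 -> A, where (a,b,c)      *)
(* indexes the monomial x0^a x1^b x2^c.                                      *)
Definition T3 := (int * int * int)%type.
Definition tr (a b c : int) : T3 := (a, b, c).

Definition mono3 (al : T3) : T3 -> C := fun e => (e == al)%:R.
Definition smul3 (f g : T3 -> C) : T3 -> C :=
  fun e => fsum (fun d : T3 => f d * g (e - d)).
Definition scale3 (r : C) (f : T3 -> C) : T3 -> C := fun e => r * f e.
Definition pow3 (f : T3 -> C) (n : nat) : T3 -> C := iter n (smul3 f) (mono3 0).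
Definition exp3 (y : T3 -> C) : T3 -> C :=
  fun e => fsum (fun n : nat => pow3 y n e / (n`!)%:R).
(* substitution t := x^al in a one-variable series *)
Definition embed3 (al : T3) (f : ser1) : T3 -> C :=
  fun e => fsum (fun n : int => if e == al *~ n then f n else 0).

(* delta(c e^y x^al) = sum_{n in Z} (c e^y x^al)^n = sum_n c^n e^{n y} x^{n al} *)
Definition delta_exp (c : C) (y : T3 -> C) (al : T3) : T3 -> C :=
  fun e => fsum (fun n : int =>
     c ^ n * smul3 (exp3 (scale3 n%:~R y)) (mono3 (al *~ n)) e).

Definition binz (n : int) (k : nat) : C :=
  (\prod_(i < k) (n%:~R - i%:R)) / (k`!)%:R.
(* delta((x^al + s x^be) / (c x^ga)) = sum_n (c x^ga)^{-n} (x^al + s x^be)^n, *)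
(* each binomial power expanded in nonnegative powers of its second term.   *)
Definition delta_bin (al : T3) (s : C) (be : T3) (c : C) (ga : T3) : T3 -> C :=
  fun e => fsum (fun p : int * nat =>
    let: (n, k) := p in
    if e == al *~ (n - k%:Z) + be *~ k%:Z - ga *~ n
    then binz n k * s ^+ k * c ^ (- n) else 0).

Variable V : lmodType C.
Definition vmul3 (f : T3 -> C) (g : T3 -> V) : T3 -> V :=
  fun e => fsum (fun d : T3 => f d *: g (e - d)).
End FormalSeries.

(* [comp n v] is the component of v in V_(n); [mode u n v] is u_n v, i.e.   *)
(* Y(u,x) = sum_n (mode u n) x^{-n-1}; [vac] is 1, [omega] is omega and     *)
(* [rank] is c.                                                              *)

Section VOADefs.
Variables (C : numClosedFieldType) (V : lmodType C).
Variables (mode : V -> int -> V -> V).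

Definition YY (u v w : V) : T3 -> V :=
  fun e => let: (a, b, c) := e in
    if a == 0 then mode u (- b - 1) (mode v (- c - 1) w) else 0.
Definition YYrev (u v w : V) : T3 -> V :=
  fun e => let: (a, b, c) := e in
    if a == 0 then mode v (- c - 1) (mode u (- b - 1) w) else 0.
Definition YYit (u v w : V) : T3 -> V :=
  fun e => let: (a, b, c) := e in
    if b == 0 then mode (mode u (- a - 1) v) (- c - 1) w else 0.

Definition jacobi_identity : Prop :=
  forall u v w : V,
    (fun e => vmul3 (smul3 (mono3 C (tr (-1) 0 0))
                           (@delta_bin C (tr 0 1 0) (-1) (tr 0 0 1) 1 (tr 1 0 0)))
                    (YY u v w) e
            - vmul3 (smul3 (mono3 C (tr (-1) 0 0))
                           (@delta_bin C (tr 0 0 1) (-1) (tr 0 1 0) (-1) (tr 1 0 0)))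
                    (YYrev u v w) e)
    = vmul3 (smul3 (mono3 C (tr 0 0 (-1)))
                   (@delta_bin C (tr 0 1 0) (-1) (tr 1 0 0) 1 (tr 0 0 1)))
            (YYit u v w).
End VOADefs.

Record VOA (C : numClosedFieldType) (V : lmodType C) := {
  comp : int -> V -> V;
  mode : V -> int -> V -> V;
  vac : V;
  omega : V;
  rank : C;
  (* grading V = coprod_n V_(n), via the projections comp n *)
  comp_linear : forall n (a : C) (v v' : V), comp n (a *: v + v') = a *: comp n v + comp n v';
  comp_comp : forall m n v, comp m (comp n v) = if m == n then comp n v else 0;
  comp_finite : forall v, exists s : seq int, v = \sum_(n <- s) comp n v;
  comp_fin_dim : forall n, exists (d : nat) (b : 'I_d -> V),
      forall v, exists c : 'I_d -> C, comp n v = \sum_(i < d) c i *: b i;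
  comp_lower : exists N : int, forall n v, n < N -> comp n v = 0;
  mode_linear_l : forall (a : C) u u' n v, mode (a *: u + u') n v = a *: mode u n v + mode u' n v;
  mode_linear_r : forall u n (a : C) v v', mode u n (a *: v + v') = a *: mode u n v + mode u n v';
  vac_wt : comp 0 vac = vac;
  omega_wt : comp 2 omega = omega;
  mode_trunc : forall u v, exists N : int, forall n, N <= n -> mode u n v = 0;
  mode_vac : forall n v, mode vac n v = if n == -1 then v else 0;
  mode_creation : forall v n, 0 <= n -> mode v n vac = 0;
  mode_creation_const : forall v, mode v (-1) vac = v;
  jacobi : jacobi_identity mode;
  (* Virasoro relations, L(n) = omega_{n+1} *)
  virasoro : forall (m n : int) v,
      mode omega (m + 1) (mode omega (n + 1) v) - mode omega (n + 1) (mode omega (m + 1) v)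
      = (m - n)%:~R *: mode omega (m + n + 1) v
        + ((m ^+ 3 - m)%:~R / 12%:R * (m + n == 0)%:R * rank) *: v;
  L0_wt : forall n v, mode omega 1 (comp n v) = n%:~R *: comp n v;
  (* d/dx Y(v,x) = Y(L(-1)v, x), i.e. (L(-1)v)_n = -n v_{n-1} *)
  L_1_deriv : forall v n, mode (mode omega 0 v) n = fun w => (- n)%:~R *: mode v (n - 1) w
}.

Section VOAOps.
Variables (C : numClosedFieldType) (V : lmodType C) (A : VOA V).

Definition L0 (v : V) : V := mode A (omega A) 1 v.

(* coefficient of x^c in X(v,x) w = Y(x^{L(0)} v, x) w
   = sum_n x^n Y(v_(n), x) w,  i.e.  sum_n (v_(n))_{n-c-1} w *)
Definition Xc (v : V) (c : int) (w : V) : V :=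
  fsum (fun n : int => mode A (comp A n v) (n - c - 1) w).

Definition XX (u v w : V) : T3 -> V :=
  fun e => let: (a, b, c) := e in if a == 0 then Xc u b (Xc v c w) else 0.
Definition XXrev (u v w : V) : T3 -> V :=
  fun e => let: (a, b, c) := e in if a == 0 then Xc v c (Xc u b w) else 0.

(* Zhu's operator Y[u,y] v = Y(e^{y L(0)} u, e^y - 1) v, evaluated at a
   one-variable series y (of positive order):
   sum_{m >= 0} sum_n  (1/m!) y^m (e^y - 1)^{-n-1} (L(0)^m u)_n v.        *)
Definition zhuY (u v : V) (y : ser1 C) : int -> V :=
  fun i => fsum (fun p : nat * int =>
    let: (m, n) := p in
    (mul1 (pow1 y m) (powz1 (add1 (exp1 y) (opp1 (one1 C))) (- n - 1)) i
       / (m`!)%:R) *: mode A (iter m L0 u) n v).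

(* X(W, x2) w for W = sum_m W_m (x0/x1)^m a series in x0/x1 with V-coeffs *)
Definition XW (W : int -> V) (w : V) : T3 -> V :=
  fun e => let: (a, b, c) := e in if b == - a then Xc (W a) c w else 0.
End VOAOps.

Definition y21 (C : numClosedFieldType) : T3 -> C := embed3 (tr 0 (-1) 1) (log1m C).
Definition y12 (C : numClosedFieldType) : T3 -> C := embed3 (tr 0 1 (-1)) (log1m C).
Definition y01 (C : numClosedFieldType) : T3 -> C := embed3 (tr 1 (-1) 0) (log1m C).
(* -y01 as a series in t = x0/x1 *)
Definition minus_y01_t (C : numClosedFieldType) : ser1 C := opp1 (log1m C).

(* Main.v *)
(* Put t = x0/x1.  Since log (1 - t) enters only through exp (n log (1 - t)) =
   (1 - t)^n, the three delta series of the theorem are those of the Jacobi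
   identity.  For u and v homogeneous of weights k and l, X(u,x1) X(v,x2) is
   x1^k x2^l Y(u,x1) Y(v,x2), so the left-hand side is the Jacobi identity
   multiplied by x1^k x2^l.  On the right, e^(-y01) - 1 = t / (1 - t), hence
   Y[u,-y01] v = sum_n t^(-n-1) (1 - t)^(n+1-k) u_n v; as u_n v has weight
   k + l - n - 1 (by the commutator of L(0) with u_n), comparing coefficients
   reduces the claim to Vandermonde's convolution for the powers of 1 - t.
   The general case follows by bilinearity, every sum being finite. *)

Require Import Defs.
From mathcomp Require Import all_boot all_order all_algebra.
From mathcomp Require Import boolp classical_sets fsbigop.
From mathcomp Require Import zify ring.
Set Implicit Arguments. Unset Strict Implicit. Unset Printing Implicit Defensive.
Import Order.TTheory GRing.Theory Num.Theory.
Local Open Scope ring_scope.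

(** * Finitely supported sums *)

Lemma eq_fsum (I : choiceType) (A : nmodType) (f g : I -> A) :
  f =1 g -> fsum f = fsum g.
Proof. by move=> fg; congr fsum; apply/funext. Qed.

Lemma fsum_seq (I : choiceType) (A : nmodType) (s : seq I) (f : I -> A) :
  uniq s -> (forall i, i \notin s -> f i = 0) -> fsum f = \sum_(i <- s) f i.
Proof.
move=> us sf; rewrite /fsum (fsbigE s) //; last by move=> i _; exact: sf.
by apply: eq_bigl => i; rewrite in_setT.
Qed.

Lemma fsum_ord (A : nmodType) (N : nat) (f : nat -> A) :
  (forall k, (N <= k)%N -> f k = 0) -> fsum f = \sum_(k < N) f k.
Proof.
move=> Nf; rewrite (@fsum_seq _ _ (index_iota 0 N)) ?iota_uniq //.
  by rewrite big_mkord.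
by move=> k; rewrite mem_index_iota -leqNgt => /Nf.
Qed.

Lemma fsum0 (I : choiceType) (A : nmodType) (f : I -> A) :
  (forall i, f i = 0) -> fsum f = 0.
Proof. by move=> f0; rewrite (@fsum_seq _ _ [::]) ?big_nil. Qed.

Lemma fsum1 (I : choiceType) (A : nmodType) (i0 : I) (f : I -> A) :
  (forall i, i != i0 -> f i = 0) -> fsum f = f i0.
Proof.
move=> f0; rewrite (@fsum_seq _ _ [:: i0]) ?big_seq1 // => i.
by rewrite inE; exact: f0.
Qed.

(* No finiteness is needed here: the two supports are in bijection, and both
   sums are the junk value [0] when these are infinite. *)
Lemma fsum_reindex (I J : choiceType) (A : nmodType) (h : I -> J) (f : J -> A) :
  injective h -> (forall j, (forall i, j != h i) -> f j = 0) ->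
  fsum f = fsum (f \o h).
Proof.
move=> hI f0; rewrite /fsum -(fsbig_widen (range h)) //.
  by rewrite fsbig_image // => x y _ _; exact: hI.
move=> j [_ /= Nj]; apply: f0 => i; apply/eqP => ji; apply: Nj.
by exists i.
Qed.

(** On an infinite support [fsum] takes the value [0], so additivity can fail; this is the condition
    under which sums are split. *)
Definition fsupp (I : choiceType) (A : nmodType) (f : I -> A) : Prop :=
  exists s : seq I, forall i, i \notin s -> f i = 0.

Lemma fsumD (I : choiceType) (A : nmodType) (f g : I -> A) :
  fsupp f -> fsupp g -> fsum (fun i => f i + g i) = fsum f + fsum g.
Proof.
move=> [s sf] [t tg]; have uU := undup_uniq (s ++ t).
have N x : x \notin undup (s ++ t) -> (x \notin s) /\ (x \notin t).
  by rewrite mem_undup mem_cat negb_or => /andP.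
rewrite !(fsum_seq uU) ?big_split // => x /N[xs xt].
- by rewrite tg.
- by rewrite sf.
- by rewrite sf // tg // addr0.
Qed.

Lemma fsupp_nat (A : nmodType) (N : nat) (f : nat -> A) :
  (forall k, (N <= k)%N -> f k = 0) -> fsupp f.
Proof.
move=> Nf; exists (iota 0 N) => k; rewrite mem_iota add0n -leqNgt; exact: Nf.
Qed.

Lemma fsum_shift (A : nmodType) (a : int) (f : int -> A) :
  fsum f = fsum (fun i => f (i + a)).
Proof.
rewrite (@fsum_reindex _ _ _ (fun i => i + a) f) //; first exact: addIr.
by move=> j /(_ (j - a)); rewrite subrK eqxx.
Qed.

(** * One variable: the series t^p (1 - t)^r and their products *)

Section OneVariable.
Variable C : numClosedFieldType.
Implicit Types (f g : ser1 C) (p q r : int).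

Lemma binz0 r : binz C r 0 = 1.
Proof. by rewrite /binz big_ord0 divr1. Qed.

Lemma binzS r (k : nat) :
  k.+1%:R * binz C r k.+1 = (r%:~R - k%:R) * binz C r k.
Proof.
rewrite /binz big_ord_recr /= factS natrM invfM.
have k1 : k.+1%:R != 0 :> C by rewrite pnatr_eq0.
move: (\prod_(i < k) _) (_ - _) (k`!%:R^-1) (k.+1%:R) k1 => x y z c c0.
by field.
Qed.

Lemma binz_small (n k : nat) : (n < k)%N -> binz C n%:Z k = 0.
Proof.
move=> nk; rewrite /binz (bigD1 (Ordinal nk)) //=.
by rewrite -pmulrn subrr !mul0r.
Qed.

(* The coefficients of [(1 - t)^r]. *)
Definition sbinz r (k : nat) : C := binz C r k * (-1) ^+ k.

Lemma sbinz0 r : sbinz r 0 = 1.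
Proof. by rewrite /sbinz binz0 mulr1. Qed.

Lemma sbinzS r (k : nat) : k.+1%:R * sbinz r k.+1 = (k%:R - r%:~R) * sbinz r k.
Proof. by rewrite /sbinz mulrA binzS exprS; ring. Qed.

(** The recurrence is (1 - t) F' = - r F read on coefficients, and k + 1 is invertible in
    characteristic zero. The bound [N] serves series whose recurrence is known only up to a
    truncation order. *)
Lemma sbinz_unique r (f : nat -> C) (N : nat) : f 0 = 1 ->
  (forall k, (k < N)%N -> k.+1%:R * f k.+1 = (k%:R - r%:~R) * f k) ->
  forall k, (k <= N)%N -> f k = sbinz r k.
Proof.
move=> f0 fS; elim=> [|k IH] kN; first by rewrite sbinz0.
have k1 : k.+1%:R != 0 :> C by rewrite pnatr_eq0.
by apply: (mulfI k1); rewrite fS // IH ?sbinzS // ltnW.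
Qed.

(** The factor n + 1 splits as k + (n + 1 - k), as in the Leibniz rule, so the convolution obeys the
    recurrence for the exponent p + q. *)
Lemma sbinz_Vandermonde p q (n : nat) :
  \sum_(k < n.+1) sbinz p k * sbinz q (n - k) = sbinz (p + q) n.
Proof.
pose S n := \sum_(k < n.+1) sbinz p k * sbinz q (n - k).
apply: (@sbinz_unique _ S n) => //.
  by rewrite /S big_ord1 subn0 !sbinz0 mulr1.
move=> {}n _; rewrite /S mulr_sumr.
transitivity (\sum_(k < n.+1) (k.+1%:R * sbinz p k.+1) * sbinz q (n - k)
   + \sum_(k < n.+1) sbinz p k * ((n - k).+1%:R * sbinz q (n - k).+1)).
  rewrite (eq_bigr (fun k : 'I_n.+2 => k%:R * sbinz p k * sbinz q (n.+1 - k)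
    + sbinz p k * ((n.+1 - k)%:R * sbinz q (n.+1 - k)))); last first.
    move=> [k /=]; rewrite ltnS => kn _; rewrite -[in LHS](subnKC kn) natrD.
    by rewrite addKn; ring.
  rewrite big_split /=; congr (_ + _).
    by rewrite big_ord_recl /= !mul0r add0r; apply: eq_bigr => k _.
  rewrite big_ord_recr /= subnn mul0r mulr0 addr0; apply: eq_bigr => k _.
  by rewrite subSn // -ltnS.
rewrite -big_split mulr_sumr; apply: eq_bigr => -[k /=]; rewrite ltnS => kn _.
rewrite !sbinzS intrD (_ : n%:R = k%:R + (n - k)%:R :> C); first by ring.
by rewrite -natrD subnKC.
Qed.

(* [tpow p r] is the series [t^p (1 - t)^r]. *)
Definition tpow p r : ser1 C :=
  fun i => if i - p is Posz k then sbinz r k else 0.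

Lemma tpow_nat p r (k : nat) : tpow p r (p + k%:Z) = sbinz r k.
Proof. by rewrite /tpow addrC addKr. Qed.

Lemma tpow_lt p r i : i < p -> tpow p r i = 0.
Proof.
move=> ip; rewrite /tpow; have : i - p < 0 by lia.
by case: (i - p).
Qed.

Lemma tpow0 p i : tpow p 0 i = (i == p)%:R.
Proof.
have [ip|pi] := ltP i p; first by rewrite tpow_lt // lt_eqF.
have -> : i = p + `|i - p|%N%:Z by lia.
rewrite tpow_nat; case: `|_|%N => [|k]; first by rewrite sbinz0 addr0 eqxx.
rewrite /sbinz (@binz_small 0) // mul0r; case: eqP => //; lia.
Qed.

Lemma mul1_nat f g p (i : int) : (forall k, k < p -> f k = 0) ->
  mul1 f g i = fsum (fun k : nat => f (p + k%:Z) * g (i - p - k%:Z)).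
Proof.
move=> f0; rewrite /mul1 (@fsum_reindex _ _ _ (fun k : nat => p + k%:Z)).
- by apply: eq_fsum => k /=; rewrite opprD addrA.
- by move=> j k /addrI [].
- move=> j jN; have [jp|pj] := ltP j p; first by rewrite f0 // mul0r.
  have /eqP[] := jN `|j - p|%N; lia.
Qed.

(** Any [N] beyond [i - p - q] will do; [N = 0] gives the vanishing of the product in degrees below
    p + q. *)
Lemma mul1_ord f g p q (N : nat) (i : int) : (forall k, k < p -> f k = 0) ->
  (forall k, k < q -> g k = 0) -> i - p - q < N%:Z ->
  mul1 f g i = \sum_(k < N) f (p + k%:Z) * g (i - p - k%:Z).
Proof.
move=> f0 g0 iN; rewrite (mul1_nat _ _ f0); apply: fsum_ord => k Nk.
rewrite g0 ?mulr0 //; lia.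
Qed.

Lemma mul1_tpow p r q s : mul1 (tpow p r) (tpow q s) = tpow (p + q) (r + s).
Proof.
apply/funext => i; have [ip|pi] := ltP i (p + q).
  rewrite (@mul1_ord _ _ p q 0) ?big_ord0 ?tpow_lt //; [exact: tpow_lt..|lia].
rewrite (_ : i = p + q + `|(i - (p + q))%R|%N%:Z); last by lia.
move: `|_|%N => n; rewrite tpow_nat -sbinz_Vandermonde.
rewrite (@mul1_ord _ _ p q n.+1); [|exact: tpow_lt..|lia].
apply: eq_bigr => -[k /=]; rewrite ltnS => kn _; rewrite tpow_nat.
by rewrite (_ : _ - p - _ = q + (n - k)%N%:Z) ?tpow_nat //; lia.
Qed.

Lemma one1_tpow : one1 C = tpow 0 0.
Proof. by apply/funext => i; rewrite tpow0. Qed.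

Lemma pow1_tpow p r (n : nat) : pow1 (tpow p r) n = tpow (p * n%:Z) (r * n%:Z).
Proof.
elim: n => [|n IH]; first by rewrite !mulr0 -one1_tpow.
rewrite /pow1 iterS -/(pow1 _ n) IH mul1_tpow; congr tpow; lia.
Qed.

(** The constant sequence 1 solves the recurrence of [sbinz] for [r = -1]. *)
Lemma tpow_geom i : tpow 1 (-1) i = (0 < i)%R%:R.
Proof.
have [i0|i0] := leP i 0; first by rewrite tpow_lt //; lia.
rewrite (_ : i = 1 + `|i - 1|%N%:Z); last by lia.
rewrite tpow_nat; symmetry.
apply: (@sbinz_unique _ (fun=> 1) `|i - 1|%N) => // k _.
by rewrite !mulr1 intrN opprK natr1.
Qed.

(** Since [inv1] picks its value by choice, exhibiting an inverse is not enough: every lower bounded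
    inverse has to be identified. *)
Lemma inv1_geom : inv1 (tpow 1 (-1)) = tpow (-1) 1.
Proof.
rewrite /inv1; case: pselect => [H|[]]; last first.
  exists (tpow (-1) 1); rewrite mul1_tpow one1_tpow; split=> //.
  by exists (-1); exact: tpow_lt.
case: (cid H) => g /= [[N gN] g1]; apply/funext => i.
pose S i := fsum (fun k : int => (0 < k)%R%:R * g (i - k)).
have SE j : S j = (j == 0)%:R.
  rewrite -[RHS]/(one1 C j) -g1 /mul1; apply: eq_fsum => k.
  by rewrite tpow_geom.
(* [g] is the difference of consecutive coefficients of [t / (1 - t) * g = 1] *)
have gE : S (i + 1) = g i + S i.
  rewrite /S (fsum_shift 1) (_ : g i = fsum (fun k => (k == 0)%:R * g (i - k))).
    rewrite -fsumD.
    - apply: eq_fsum => k; rewrite -mulrDl (_ : i + 1 - (k + 1) = i - k); last lia.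
      congr (_ * _); case: (ltgtP k 0) => k0.
      + by rewrite (_ : (0 < k + 1) = false) ?addr0 //; lia.
      + by rewrite (_ : (0 < k + 1) = true) ?add0r //; lia.
      + by rewrite k0 addr0.
    - by exists [:: 0] => k; rewrite inE => /negPf->; rewrite mul0r.
    (* Only 0 < k <= i - N contributes, by the lower bound [N] of [g]. *)
    - exists [seq k%:Z | k <- iota 0 `|i - N|.+1] => k kN.
      have [k0|k0] := ltP 0 k; last by rewrite mul0r.
      rewrite gN ?mulr0 //; apply: contraNT kN; rewrite -leNgt => kN.
      apply/mapP; exists `|k|%N; last lia.
      by rewrite mem_iota; lia.
  rewrite (@fsum1 _ _ 0) ?eqxx ?mul1r ?subr0 // => k /negPf->.
  by rewrite mul0r.
(* Hence g = t^(-1) - 1 = t^(-1) (1 - t); the remaining cases compare coefficients. *)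
have -> : g i = S (i + 1) - S i by rewrite gE addrK.
rewrite !SE; have [->|] := eqVneq i 0.
  rewrite [RHS](tpow_nat (-1) 1 1) sub0r.
  by rewrite /sbinz /binz big_ord1 subr0 divr1 mul1r.
have [->|i1 i0] := eqVneq i (-1).
  by rewrite -[X in tpow _ _ X]addr0 tpow_nat sbinz0 subr0.
rewrite (_ : (i + 1 == 0) = false); last lia.
have [i2|i2] := ltP i (-1); first by rewrite tpow_lt // subr0.
rewrite (_ : i = (-1) + `|(i + 1)%R|%N%:Z); last lia.
rewrite tpow_nat /sbinz (@binz_small 1%N) ?mul0r ?subr0 //; lia.
Qed.

Lemma powz1_geom p : powz1 (tpow 1 (-1)) p = tpow p (- p).
Proof.
case: p => n; rewrite /powz1 ?inv1_geom pow1_tpow; first by congr tpow; lia.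
by congr tpow; lia.
Qed.

(** * The exponential of r log (1 - t) *)

Definition scale1 (c : C) f : ser1 C := fun i => c * f i.

(** Truncation gives access to the formal derivative and to divisibility by powers of ['X] in
    [{poly C}]. *)
Definition trunc1 (N : nat) f : {poly C} := \poly_(i < N) f i%:Z.

Definition eqp_mod (N : nat) (P Q : {poly C}) :=
  forall i, (i < N)%N -> P`_i = Q`_i.

Lemma eqp_modM N P P' Q Q' :
  eqp_mod N P P' -> eqp_mod N Q Q' -> eqp_mod N (P * Q) (P' * Q').
Proof.
move=> eP eQ i iN; rewrite !coefM; apply: eq_bigr => -[j /=]; rewrite ltnS => ji _.
by rewrite eP ?eQ //; [exact: leq_ltn_trans (leq_subr _ _) iN|exact: leq_ltn_trans iN].
Qed.

Lemma pow1_lt f (n : nat) i : (forall k, k < 1 -> f k = 0) ->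
  i < n%:Z -> pow1 f n i = 0.
Proof.
move=> f0; elim: n i => [|n IH] i iN.
  by rewrite /pow1 /= /one1 lt_eqF.
rewrite /pow1 iterS -/(pow1 f n) (@mul1_ord _ _ 1 n%:Z 0) ?big_ord0 //; lia.
Qed.

Lemma pow1_trunc f (N n : nat) : (forall k, k < 1 -> f k = 0) ->
  forall i, (i < N)%N -> pow1 f n i%:Z = (trunc1 N f ^+ n)`_i.
Proof.
move=> f0; elim: n => [|n IH] i iN; first by rewrite expr0 coef1.
rewrite /pow1 iterS -/(pow1 f n) (@mul1_ord _ _ 0 0 i.+1).
- rewrite exprS coefM; apply: eq_bigr => -[j /=]; rewrite ltnS => ji _.
  have jN := leq_ltn_trans ji iN.
  rewrite coef_poly jN add0r -IH; last exact: leq_ltn_trans (leq_subr _ _) iN.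
  by congr (_ * pow1 _ _ _); lia.
- by move=> k k0; apply: f0; lia.
- by move=> k k0; apply: pow1_lt => //; lia.
- lia.
Qed.

Lemma pow1_scale c f n i : pow1 (scale1 c f) n i = c ^+ n * pow1 f n i.
Proof.
elim: n i => [|n IH] i; first by rewrite expr0 mul1r.
rewrite /pow1 !iterS -!/(pow1 _ n) /mul1 exprS.
rewrite [RHS]mulr_fsumr; apply: eq_fsum => k.
by rewrite IH /scale1; ring.
Qed.

Lemma exp1_ord f (N : nat) i : (forall k, k < 1 -> f k = 0) -> i < N%:Z ->
  exp1 f i = \sum_(n < N) pow1 f n i / n`!%:R.
Proof.
move=> f0 iN; apply: fsum_ord => n Nn; rewrite pow1_lt ?mul0r //; lia.
Qed.

Lemma log1m_lt (k : int) : k < 1 -> log1m C k = 0.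
Proof. by move=> k1; rewrite /log1m (_ : (0 < k) = false) //; lia. Qed.

(* [E = exp (r log (1 - t))] satisfies [(1 - t) E' = - r E], which is the
   recurrence defining the coefficients of [(1 - t)^r]. *)
Lemma exp1_log r : exp1 (scale1 r%:~R (log1m C)) = tpow 0 r.
Proof.
set f := scale1 _ _; have f0 k : k < 1 -> f k = 0.
  by move=> k1; rewrite /f /scale1 log1m_lt // mulr0.
apply/funext => -[j|j]; last first.
  by rewrite (@exp1_ord _ 0) // big_ord0 tpow_lt.
rewrite -[in RHS](add0r (Posz j)) tpow_nat.
(* [P] is kept up to degree [N], one more than the congruences modulo ['X^N] need, because
   differentiation lowers degrees by one. *)
pose N := j.+1; pose P := trunc1 N.+1 f.
pose E M := \sum_(n < M) n`!%:R^-1 *: P ^+ n.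
have eE k : (k <= N)%N -> exp1 f k = (E N.+1)`_k.
  move=> kN; rewrite (@exp1_ord _ N.+1) // coef_sum; apply: eq_bigr => n _.
  by rewrite coefZ mulrC (@pow1_trunc _ N.+1).
have P0 : P`_0 = 0 by rewrite coef_poly f0.
have XP M : 'X^M %| P ^+ M.
  by apply: dvdp_exp2r; rewrite -['X]subr0 -polyC0 dvdp_XsubCl rootE horner_coef0 P0.
(* The derivative of the truncated exponential is P' times the sum with one term fewer; the missing
   term is a multiple of P^N, which ['X^N] divides. *)
have dE : eqp_mod N (E N.+1)^`() (P^`() * E N.+1).
  move=> i iN; rewrite /E raddf_sum big_ord_recl /= expr0 derivZ derivC scaler0 add0r.
  rewrite [in RHS]big_ord_recr /= mulrDr coefD -scalerAr coefZ.
  have /dvdpP[Q ->] := XP N; rewrite [_ * (_ * _)]mulrA coefMXn iN mulr0 addr0.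
  rewrite mulr_sumr; congr ((polyseq _)`_i); apply: eq_bigr => n _.
  rewrite derivZ deriv_exp -scalerAr /bump leq0n add1n /= -scaler_nat scalerA.
  rewrite factS natrM invfM mulrAC mulVf ?pnatr_eq0 // mul1r.
  done.
(* Below degree [N] all coefficients of P' equal - r, so multiplication by 1 - X leaves only the
   constant one. *)
have dP : eqp_mod N ((1 - 'X) * P^`()) (- r%:~R)%:P.
  move=> i iN; rewrite mulrBl mul1r coefB coefXM !coef_deriv coefC.
  have fS k : (k <= i)%N -> P`_k.+1 *+ k.+1 = - r%:~R.
    move=> ki; rewrite coef_poly ltnS (leq_trans _ iN) // /f /scale1 /log1m /=.
    rewrite -mulr_natr mulrN mulNr mulfVK //.
    by rewrite pnatr_eq0.
  case: i iN fS => [|i] iN fS /=; first by rewrite fS // subr0.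
  by rewrite !fS // subrr.
apply: (@sbinz_unique _ (fun k => exp1 f k%:Z) N) => //.
  rewrite (@exp1_ord _ 1) // big_ord1 /pow1 /= /one1 eqxx.
  by rewrite fact0 divr1.
move=> k kN; rewrite !eE ?(ltnW kN) //.
have eE1 : eqp_mod N (E N.+1) (E N.+1) by [].
have e1 : eqp_mod N (1 - 'X) (1 - 'X) by [].
have := eqp_modM e1 dE kN.
rewrite mulrA (eqp_modM dP eE1 kN) mul_polyC coefZ mulrBl mul1r coefB coefXM !coef_deriv.
case: k kN => [|k] kN /= e.
  by rewrite mul1r sub0r -e subr0.
rewrite mulrBl -mulNr -e !mulr_natl; ring.
Qed.

End OneVariable.

(** * Three variables: delta series and their action on vector-valued series *)

Section ThreeVariables.
Variable C : numClosedFieldType.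
Implicit Types (f g : ser1 C) (al be ga mu e : T3).

Lemma tr_mulz (a b c n : int) : tr a b c *~ n = tr (a * n) (b * n) (c * n).
Proof.
have E (m : nat) (x y z : int) : tr x y z *+ m = tr (x * m%:Z) (y * m%:Z) (z * m%:Z).
  elim: m => [|m IH]; first by rewrite !mulr0.
  by rewrite mulrS IH; congr (_, _, _); rewrite /=; lia.
case: n => n; first exact: E.
rewrite NegzE mulrNz -pmulrn E; congr (_, _, _); rewrite /=; lia.
Qed.

Lemma trD (a b c a' b' c' : int) :
  tr a b c + tr a' b' c' = tr (a + a') (b + b') (c + c').
Proof. by []. Qed.

Lemma trN (a b c : int) : - tr a b c = tr (- a) (- b) (- c).
Proof. by []. Qed.

Definition trE := (tr_mulz, trN, trD).

Lemma embed3E al f n : injective (fun n => al *~ n) -> embed3 al f (al *~ n) = f n.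
Proof.
move=> alI; rewrite /embed3 (@fsum1 _ _ n) ?eqxx // => m mn.
by case: eqP => // /alI nm; rewrite nm eqxx in mn.
Qed.

Lemma embed30 al f e : (forall n, e != al *~ n) -> embed3 al f e = 0.
Proof. by move=> eN; apply: fsum0 => n; rewrite (negPf (eN n)). Qed.

(** The exponents [al *~ n] are distinct, so a series in x^al is determined by its values on this
    line and by vanishing off it. The operations on one-variable series are transported to three
    variables this way. *)
Lemma embed3P al f (h : T3 -> C) : injective (fun n => al *~ n) ->
  (forall n, h (al *~ n) = f n) -> (forall e, (forall n, e != al *~ n) -> h e = 0) ->
  h = embed3 al f.
Proof.
move=> alI hE h0; apply/funext => e.
have [[n ->]|eN] := pselect (exists n, e = al *~ n); first by rewrite hE embed3E.
have {}eN n : e != al *~ n by apply/eqP => en; apply: eN; exists n.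
by rewrite h0 // embed30.
Qed.

Lemma smul3_embed al f g : injective (fun n => al *~ n) ->
  smul3 (embed3 al f) (embed3 al g) = embed3 al (mul1 f g).
Proof.
move=> alI; apply: embed3P => // [n|e eN].
  rewrite /smul3 /mul1 (@fsum_reindex _ _ _ (fun k => al *~ k)) //.
    by apply: eq_fsum => k; rewrite /= -mulrzBr !embed3E.
  by move=> d /embed30->; rewrite mul0r.
apply: fsum0 => d; have [[k ->]|dN] := pselect (exists k, d = al *~ k); last first.
  by rewrite embed30 ?mul0r // => k; apply/eqP => dk; apply: dN; exists k.
rewrite [X in _ * X]embed30 ?mulr0 // => n; rewrite subr_eq -mulrzDr.
exact: eN.
Qed.

Lemma pow3_embed al f n : injective (fun n => al *~ n) ->
  pow3 (embed3 al f) n = embed3 al (pow1 f n).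
Proof.
move=> alI; elim: n => [|n IH]; last by rewrite /pow3 iterS -/(pow3 _ n) IH smul3_embed.
apply: embed3P => // [n|e eN]; rewrite /pow3 /= /mono3 /one1.
  by rewrite -[X in _ == X](mulr0z al) (inj_eq alI).
by rewrite -[X in _ == X](mulr0z al) (negPf (eN 0)).
Qed.

Lemma scale3_embed al f c : injective (fun n => al *~ n) ->
  scale3 c (embed3 al f) = embed3 al (scale1 c f).
Proof.
move=> alI; apply: embed3P => // [n|e eN]; rewrite /scale3.
  by rewrite embed3E.
by rewrite embed30 ?mulr0.
Qed.

Lemma exp3_embed al f : injective (fun n => al *~ n) ->
  exp3 (embed3 al f) = embed3 al (exp1 f).
Proof.
move=> alI; apply: embed3P => // [n|e eN].
  by apply: eq_fsum => k; rewrite pow3_embed // embed3E.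
by apply: fsum0 => k; rewrite pow3_embed // embed30 ?mul0r.
Qed.

Lemma smul3_mono (F : T3 -> C) mu e : smul3 F (mono3 C mu) e = F (e - mu).
Proof.
rewrite /smul3 (@fsum1 _ _ (e - mu)); first by rewrite subKr /mono3 eqxx mulr1.
move=> d dN; rewrite /mono3; case: eqP => [E|]; last by rewrite mulr0.
by rewrite -E subKr eqxx in dN.
Qed.

Lemma mono3_smul (F : T3 -> C) mu e : smul3 (mono3 C mu) F e = F (e - mu).
Proof.
rewrite /smul3 (@fsum1 _ _ mu); first by rewrite /mono3 eqxx mul1r.
by move=> d /negPf dN; rewrite /mono3 dN mul0r.
Qed.

(** The exponent equals [(al - ga) *~ n + (be - al) *~ k], so independence of the two directions
    lets each monomial of a binomial delta series come from a single pair (n, k). *)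
Lemma bin_expo_inj al be ga :
  injective (fun p : int * int => (al - ga) *~ p.1 + (be - al) *~ p.2) ->
  injective (fun p : int * nat => al *~ (p.1 - p.2%:Z) + be *~ p.2%:Z - ga *~ p.1).
Proof.
move=> I [n k] [m l] /= E.
suff [-> ->] : (n, k%:Z) = (m, l%:Z) by [].
apply: I => /=; move: E; rewrite !mulrzBl !mulrzBr => E.
transitivity (al *~ n - al *~ k + be *~ k - ga *~ n).
  by rewrite [RHS]addrAC -!addrA; congr (_ + _); rewrite addrCA; congr (_ + _); rewrite addrC.
rewrite E [LHS]addrAC -!addrA; congr (_ + _); rewrite addrCA; congr (_ + _).
by rewrite addrC.
Qed.

Lemma delta_binE al s be c ga n (k : nat) :
  injective (fun p : int * int => (al - ga) *~ p.1 + (be - al) *~ p.2) ->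
  delta_bin al s be c ga (al *~ (n - k%:Z) + be *~ k%:Z - ga *~ n)
  = binz C n k * s ^+ k * c ^ (- n).
Proof.
move=> I; rewrite /delta_bin (@fsum1 _ _ (n, k)) ?eqxx // => -[m l] ml.
case: eqP => // E; rewrite (_ : (m, l) = (n, k)) ?eqxx // in ml.
exact/esym/(bin_expo_inj I).
Qed.

Lemma delta_bin0 al (s : C) be c ga e :
  (forall n (k : nat), e != al *~ (n - k%:Z) + be *~ k%:Z - ga *~ n) ->
  delta_bin al s be c ga e = 0.
Proof. by move=> eN; apply: fsum0 => -[n k]; rewrite (negPf (eN n k)). Qed.

(** With z = x^(be - al), the n-th power of c (1 - z) x^(al - ga) is that of (x^al - x^be) / (c^(-1)
    x^ga). The constant is inverted because [delta_bin] puts it in the denominator. *)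
Lemma delta_exp_bin (c : C) al be ga :
  injective (fun p : int * int => (al - ga) *~ p.1 + (be - al) *~ p.2) ->
  delta_exp c (embed3 (be - al) (log1m C)) (al - ga) = delta_bin al (-1) be c^-1 ga.
Proof.
move=> I; have I1 : injective (fun n => (be - al) *~ n).
  move=> n m E; suff [] : (0 : int, n) = (0 : int, m) by [].
  by apply: I; rewrite /= E.
have expo n k : al *~ (n - k) + be *~ k - ga *~ n = (al - ga) *~ n + (be - al) *~ k.
  rewrite !mulrzBl mulrzBr [RHS]addrAC -!addrA; congr (_ + _).
  by rewrite [RHS]addrCA; congr (_ + _); rewrite addrC -addrA.
pose F e n := c ^ n * embed3 (be - al) (tpow C 0 n) (e - (al - ga) *~ n).
have dE e : delta_exp c (embed3 (be - al) (log1m C)) (al - ga) e = fsum (F e).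
  apply: eq_fsum => n; rewrite smul3_mono scale3_embed // exp3_embed //.
  by rewrite exp1_log.
apply/funext => e; rewrite dE.
have [[n [k ->]]|eN] := pselect (exists n (k : nat),
   e = al *~ (n - k%:Z) + be *~ k%:Z - ga *~ n).
  rewrite delta_binE // (@fsum1 _ _ n) => [|m mn].
    rewrite /F expo (addrC ((al - ga) *~ n)) addrK embed3E // -[X in tpow _ _ _ X]add0r tpow_nat.
    by rewrite /sbinz mulrC exprz_inv opprK.
  rewrite /F embed30 ?mulr0 // => j; rewrite expo; apply: contraNneq mn => E.
  suff [->] : (n, k%:Z) = (m, j) by [].
  by apply: I; rewrite /= -E [RHS]addrC subrK.
rewrite delta_bin0; last by move=> n k; apply/eqP => E; apply: eN; exists n, k.
apply: fsum0 => n; rewrite /F.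
have [[k E]|kN] := pselect (exists k, e - (al - ga) *~ n = (be - al) *~ k).
  (* Negative [k] contributes nothing, as the powers of 1 - t have no negative degrees. *)
  rewrite E embed3E //; case: k E => k E; last by rewrite tpow_lt ?mulr0.
  by case: eN; exists n, k; rewrite expo -E addrC subrK.
by rewrite embed30 ?mulr0 // => k; apply/eqP => E; apply: kN; exists k.
Qed.

Variable V : lmodType C.

Lemma vmul3_delta_bin al (s : C) be c ga mu (G : T3 -> V) e :
  injective (fun p : int * int => (al - ga) *~ p.1 + (be - al) *~ p.2) ->
  vmul3 (smul3 (mono3 C mu) (delta_bin al s be c ga)) G e
  = fsum (fun p : int * nat => (binz C p.1 p.2 * s ^+ p.2 * c ^ (- p.1)) *:
      G (e - mu - (al *~ (p.1 - p.2%:Z) + be *~ p.2%:Z - ga *~ p.1))).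
Proof.
move=> I; pose h (p : int * nat) := al *~ (p.1 - p.2%:Z) + be *~ p.2%:Z - ga *~ p.1.
rewrite /vmul3 (@fsum_reindex _ _ _ (fun p => mu + h p)).
- apply: eq_fsum => -[n k] /=; rewrite mono3_smul [_ + h _ - mu]addrC addKr.
  by rewrite delta_binE // opprD addrA.
- by move=> p q /addrI /(bin_expo_inj I).
- move=> d dN; rewrite mono3_smul delta_bin0 ?scale0r // => n k.
  have := dN (n, k); apply: contraNneq => E.
  by rewrite /h /= -E addrC subrK.
Qed.

Lemma vmul3_shift (F : T3 -> C) (G : T3 -> V) (mu e : T3) :
  vmul3 F (fun d => G (d - mu)) e = vmul3 F G (e - mu).
Proof. by apply: eq_fsum => d; rewrite addrAC. Qed.

(** The series multiplied by a delta involves only two independent monomials, which forces [n] once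
    [k] is given and collapses the double sum. *)
Lemma fsum_slice (G : int * nat -> V) (h : nat -> int) :
  (forall (n : int) k, n != h k -> G (n, k) = 0) -> fsum G = fsum (fun k => G (h k, k)).
Proof.
move=> G0; rewrite (@fsum_reindex _ _ _ (fun k => (h k, k))) //.
  by move=> k l [].
move=> [n k] nk; apply: G0; have := nk k.
by apply: contraNneq => ->.
Qed.

Lemma expo1_inj : injective (fun p : int * int =>
  (tr 0 1 0 - tr 1 0 0) *~ p.1 + (tr 0 0 1 - tr 0 1 0) *~ p.2).
Proof. by move=> [n k] [m l] /=; rewrite !trE => -[*]; congr (_, _); lia. Qed.

Lemma expo2_inj : injective (fun p : int * int =>
  (tr 0 0 1 - tr 1 0 0) *~ p.1 + (tr 0 1 0 - tr 0 0 1) *~ p.2).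
Proof. by move=> [n k] [m l] /=; rewrite !trE => -[*]; congr (_, _); lia. Qed.

Lemma expo3_inj : injective (fun p : int * int =>
  (tr 0 1 0 - tr 0 0 1) *~ p.1 + (tr 1 0 0 - tr 0 1 0) *~ p.2).
Proof. by move=> [n k] [m l] /=; rewrite !trE => -[*]; congr (_, _); lia. Qed.

Lemma vmul3_delta1 (G : T3 -> V) a b c :
  (forall a' b' c' : int, a' != 0 -> G (tr a' b' c') = 0) ->
  vmul3 (smul3 (mono3 C (tr (-1) 0 0))
           (delta_bin (tr 0 1 0) (-1) (tr 0 0 1) 1 (tr 1 0 0))) G (tr a b c)
  = fsum (fun k : nat => sbinz C (- a - 1) k *:
      G (tr 0 (b + a + 1 + k%:Z) (c - k%:Z))).
Proof.
move=> G0; rewrite (vmul3_delta_bin _ _ _ _ _ expo1_inj).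
rewrite (@fsum_slice _ (fun=> - a - 1)) => [|n k nk] /=; last first.
  by rewrite !trE G0 ?scaler0 //=; lia.
apply: eq_fsum => k /=; rewrite exp1rz mulr1; congr (_ *: G _).
by rewrite !trE; congr tr; rewrite /=; lia.
Qed.

(** The sign is the power - n of the constant -1 in the denominator - x0, at n = - a - 1. *)
Lemma vmul3_delta2 (G : T3 -> V) a b c :
  (forall a' b' c' : int, a' != 0 -> G (tr a' b' c') = 0) ->
  vmul3 (smul3 (mono3 C (tr (-1) 0 0))
           (delta_bin (tr 0 0 1) (-1) (tr 0 1 0) (-1) (tr 1 0 0))) G (tr a b c)
  = fsum (fun k : nat => (sbinz C (- a - 1) k * (-1) ^ (a + 1)) *:
      G (tr 0 (b - k%:Z) (c + a + 1 + k%:Z))).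
Proof.
move=> G0; rewrite (vmul3_delta_bin _ _ _ _ _ expo2_inj).
rewrite (@fsum_slice _ (fun=> - a - 1)) => [|n k nk] /=; last first.
  by rewrite !trE G0 ?scaler0 //=; lia.
apply: eq_fsum => k /=; rewrite (_ : - (- a - 1) = a + 1); last lia.
congr (_ *: G _).
by rewrite !trE; congr tr; rewrite /=; lia.
Qed.

(** [h] is left general for two uses: [YYit] does not involve x1, which forces n = b + k, while [XW]
    involves x0 and x1 only through x0/x1, which forces n = a + b. *)
Lemma vmul3_delta3 (G : T3 -> V) (h : nat -> int) a b c :
  (forall (n : int) (k : nat), n != h k ->
     G (tr (a - k%:Z) (b - n + k%:Z) (c + n + 1)) = 0) ->
  vmul3 (smul3 (mono3 C (tr 0 0 (-1)))
           (delta_bin (tr 0 1 0) (-1) (tr 1 0 0) 1 (tr 0 0 1))) G (tr a b c)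
  = fsum (fun k : nat => sbinz C (h k) k *:
      G (tr (a - k%:Z) (b - h k + k%:Z) (c + h k + 1))).
Proof.
move=> G0; rewrite (vmul3_delta_bin _ _ _ _ _ expo3_inj).
have E n (k : nat) : tr a b c - tr 0 0 (-1) - (tr 0 1 0 *~ (n - k%:Z)
    + tr 1 0 0 *~ k%:Z - tr 0 0 1 *~ n)
    = tr (a - k%:Z) (b - n + k%:Z) (c + n + 1).
  by rewrite !trE; congr tr; rewrite /=; lia.
rewrite (@fsum_slice _ h) => [|n k nk] /=.
  by apply: eq_fsum => k /=; rewrite exp1rz mulr1 E.
by rewrite E G0 ?scaler0.
Qed.

End ThreeVariables.

(** Terms with k + j >= M vanish, so the square may be replaced by the triangle k + j < M, which is
    then sliced by n = k + j. *)
Lemma sum_antidiag (A : nmodType) (M : nat) (F : nat -> nat -> A) :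
  (forall k j, (M <= k + j)%N -> F k j = 0) ->
  \sum_(k < M) \sum_(j < M) F k j = \sum_(n < M) \sum_(k < n.+1) F k (n - k)%N.
Proof.
move=> F0.
transitivity (\sum_(n < M) \sum_(k < M | (k <= n)%N) F k (n - k)%N); last first.
  apply: eq_bigr => -[n /= nM] _.
  by rewrite (big_ord_widen_cond M xpredT (fun k => F k (n - k)%N)).
rewrite [RHS](exchange_big_dep xpredT) //=; apply: eq_bigr => -[k /= kM] _.
transitivity (\sum_(0 + k <= n < M) F k (n - k)%N); last first.
  by rewrite (@big_nat_widenl _ _ _ (0 + k) 0%N) // add0n big_mkord.
rewrite big_addn big_mkord.
rewrite (big_ord_widen_cond M xpredT (fun j => F k (j + k - k)%N)) ?leq_subr //.
rewrite [RHS]big_mkcond /=; apply: eq_bigr => j _.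
case: ltnP => [_|jM]; first by rewrite addnK.
by apply: F0; rewrite -leq_subLR.
Qed.

(** * Vertex operator algebras: linearity, weights and truncation *)

Section VertexOperatorAlgebra.
Variables (C : numClosedFieldType) (V : lmodType C) (A : VOA V).
Local Notation comp := Defs.comp.
Implicit Types (u v w x : V) (k l m n : int).

Lemma modeDl u u' n v : mode A (u + u') n v = mode A u n v + mode A u' n v.
Proof. by have := mode_linear_l A 1 u u' n v; rewrite !scale1r. Qed.

Lemma modeDr u n v v' : mode A u n (v + v') = mode A u n v + mode A u n v'.
Proof. by have := mode_linear_r A u n 1 v v'; rewrite !scale1r. Qed.

Lemma mode0l n v : mode A 0 n v = 0.
Proof. by apply: (addrI (mode A 0 n v)); rewrite -modeDl !addr0. Qed.

Lemma mode0r u n : mode A u n 0 = 0.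
Proof. by apply: (addrI (mode A u n 0)); rewrite -modeDr !addr0. Qed.

Lemma modeZl a u n v : mode A (a *: u) n v = a *: mode A u n v.
Proof. by have := mode_linear_l A a u 0 n v; rewrite !addr0 mode0l addr0. Qed.

Lemma modeZr u n a v : mode A u n (a *: v) = a *: mode A u n v.
Proof. by have := mode_linear_r A u n a v 0; rewrite !addr0 mode0r addr0. Qed.

Lemma compD n v v' : comp A n (v + v') = comp A n v + comp A n v'.
Proof. by have := comp_linear A n 1 v v'; rewrite !scale1r. Qed.

Lemma comp0 n : comp A n 0 = 0.
Proof. by apply: (addrI (comp A n 0)); rewrite -compD !addr0. Qed.

Lemma compZ n a v : comp A n (a *: v) = a *: comp A n v.
Proof. by have := comp_linear A n a v 0; rewrite !addr0 comp0 addr0. Qed.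

(** Every vector is a finite sum of its components; the empty sum is covered because 0 is
    homogeneous of weight 0. *)
Lemma homog_ind (P : V -> Prop) : (forall u u', P u -> P u' -> P (u + u')) ->
  (forall k u, comp A k u = u -> P u) -> forall u, P u.
Proof.
move=> PD Ph u; have [s ->] := comp_finite A u.
apply: (big_ind P) => //; first by apply: (Ph 0); rewrite comp0.
by move=> n _; apply: (Ph n); rewrite comp_comp eqxx.
Qed.

Lemma comp_homog k n u : comp A k u = u -> comp A n u = if n == k then u else 0.
Proof. by move=> ku; rewrite -{1}ku comp_comp ku. Qed.

Lemma comp_fsupp u : exists s : seq int, forall n, n \notin s -> comp A n u = 0.
Proof.
elim/homog_ind: u => [u u' [s su] [t tu]|k u ku].
  exists (s ++ t) => n; rewrite mem_cat negb_or => /andP[ns nt].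
  by rewrite compD su // tu // addr0.
by exists [:: k] => n; rewrite inE (comp_homog _ ku) => /negPf->.
Qed.

Lemma comp_eq0 x : (forall n, comp A n x = 0) -> x = 0.
Proof.
by move=> x0; have [s ->] := comp_finite A x; apply: big1 => n _; exact: x0.
Qed.

Lemma L0D u u' : L0 A (u + u') = L0 A u + L0 A u'.
Proof. exact: modeDr. Qed.

Lemma L0_homog k u : comp A k u = u -> L0 A u = k%:~R *: u.
Proof. by move=> ku; rewrite /L0 -{1}ku L0_wt ku. Qed.

Lemma comp_L0 n x : comp A n (L0 A x) = n%:~R *: comp A n x.
Proof.
elim/homog_ind: x => [u u' IH IH'|k u ku]; first by rewrite L0D !compD IH IH' scalerDr.
rewrite (L0_homog ku) compZ (comp_homog _ ku).
by case: eqP => [->|] //; rewrite !scaler0.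
Qed.

(** Projecting the eigenvalue equation to V_(n) gives (k - n) x_(n) = 0, so in characteristic zero
    only the component of weight k survives. *)
Lemma L0_eigen k x : L0 A x = k%:~R *: x -> comp A k x = x.
Proof.
move=> Lx; apply/eqP; rewrite -subr_eq0; apply/eqP/comp_eq0 => n.
rewrite -scaleN1r compD compZ comp_comp; case: eqVneq => [->|nk].
  by rewrite scaleN1r subrr.
have := comp_L0 n x; rewrite Lx compZ => /eqP.
rewrite -subr_eq0 -scalerBl scaler_eq0 subr_eq0 eqr_int eq_sym (negPf nk) /=.
by move=> /eqP->; rewrite scaler0 addr0.
Qed.

Lemma YY_out u v w a b c : a != 0 -> YY (mode A) u v w (tr a b c) = 0.
Proof. by rewrite /YY /tr => /negPf->. Qed.

Lemma YYrev_out u v w a b c : a != 0 -> YYrev (mode A) u v w (tr a b c) = 0.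
Proof. by rewrite /YYrev /tr => /negPf->. Qed.

Lemma vmul3_YYit u v w a b c :
  vmul3 (smul3 (mono3 C (tr 0 0 (-1)))
           (delta_bin (tr 0 1 0) (-1) (tr 1 0 0) 1 (tr 0 0 1)))
        (YYit (mode A) u v w) (tr a b c)
  = fsum (fun k : nat => sbinz C (b + k%:Z) k *:
      mode A (mode A u (k%:Z - a - 1) v) (- b - c - k%:Z - 2) w).
Proof.
rewrite (@vmul3_delta3 _ _ _ (fun k : nat => b + k%:Z)).
  apply: eq_fsum => k; rewrite /YYit /tr (_ : _ + _ == 0); last lia.
  by congr (_ *: mode A (mode A u _ v) _ w); lia.
by move=> n k nk; rewrite /YYit /tr ifF //; lia.
Qed.

(* The coefficient of [x0^-1 x1^-2] in the Jacobi identity for [omega] and [u]. *)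
Lemma L0_commutator u n v :
  L0 A (mode A u n v) = mode A (L0 A u) n v - (n + 1)%:~R *: mode A u n v
    + mode A u n (L0 A v).
Proof.
have := congr1 (fun F => F (tr (-1) (-2) (- n - 1))) (jacobi A (omega A) u v).
rewrite vmul3_delta1 ?vmul3_delta2 ?vmul3_YYit; [|exact: YYrev_out|exact: YY_out].
(* At a = -1 the delta series on the left carry the exponent - a - 1 = 0, so only k = 0 remains in
   both sums. *)
have s0 (k : nat) : (0 < k)%N -> sbinz C 0 k = 0.
  by move=> k0; rewrite /sbinz (@binz_small _ 0) ?mul0r.
rewrite (@fsum1 _ _ 0%N) => [|k k0]; last first.
  by rewrite s0 ?scale0r // lt0n.
rewrite (@fsum1 _ _ 0%N) => [|k k0]; last first.
  by rewrite s0 ?mul0r ?scale0r // lt0n.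
(* On the right the coefficient is that of t^k in (1 - t)^(k - 2), zero for k >= 2; what remains are
   the terms of L(-1)u and L(0)u. *)
rewrite (@fsum_ord _ 2); last first.
  move=> k k2; rewrite (_ : - 2 + k%:Z = (k - 2)%N%:Z); last lia.
  rewrite /sbinz binz_small ?mul0r ?scale0r //; lia.
rewrite !big_ord_recl big_ord0 addr0 /= !sbinz0 !mul1r !scale1r.
have -> : sbinz C (- 2 + 1%N%:Z) 1 = 1.
  by have := tpow_geom C 2; rewrite (tpow_nat C 1 (-1) 1).
rewrite scale1r /YY /YYrev /tr /=.
rewrite !addr0 (_ : - (- 2 - 1 + 1) - 1 = 1) // (_ : - (- n - 1) - 1 = n); last lia.
rewrite (_ : - (- n - 1 - 1 + 1) - 1 = n); last lia.
rewrite (_ : 0%N%:Z - -1 - 1 = 0) //.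
rewrite (_ : - -2 - (- n - 1) - 2 = n + 1); last lia.
rewrite (_ : - -2 - (- n - 1) - (bump 0 0)%:Z - 2 = n); last by rewrite /bump /=; lia.
(* The derivative property turns (L(-1)u)_(n+1) into - (n + 1) u_n. *)
rewrite L_1_deriv addrK intrN scaleNr => /eqP; rewrite subr_eq => /eqP.
by rewrite /L0 => ->; rewrite [X in X + _]addrC.
Qed.

Lemma mode_wt k l n u v : comp A k u = u -> comp A l v = v ->
  comp A (k + l - n - 1) (mode A u n v) = mode A u n v.
Proof.
move=> ku lv; apply: L0_eigen; rewrite L0_commutator (L0_homog ku) (L0_homog lv).
rewrite modeZl modeZr -scalerBl -scalerDl -!intrB -intrD; congr (_%:~R *: _); lia.
Qed.

Lemma Xc_fsupp u c w : fsupp (fun n => mode A (comp A n u) (n - c - 1) w).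
Proof. by have [s su] := comp_fsupp u; exists s => n /su->; rewrite mode0l. Qed.

Lemma XcDl u u' c w : Xc A (u + u') c w = Xc A u c w + Xc A u' c w.
Proof.
rewrite /Xc -fsumD; try exact: Xc_fsupp.
by apply: eq_fsum => n; rewrite compD modeDl.
Qed.

Lemma XcDr u c w w' : Xc A u c (w + w') = Xc A u c w + Xc A u c w'.
Proof.
rewrite /Xc -fsumD; try exact: Xc_fsupp.
by apply: eq_fsum => n; rewrite modeDr.
Qed.

Lemma XcZl (r : C) x c w : Xc A (r *: x) c w = r *: Xc A x c w.
Proof.
have [s sx] := comp_fsupp x; rewrite /Xc !(@fsum_seq _ _ (undup s)) ?undup_uniq //.
- by rewrite scaler_sumr; apply: eq_bigr => n _; rewrite compZ modeZl.
- by move=> n; rewrite mem_undup => /sx->; rewrite mode0l.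
- by move=> n; rewrite mem_undup => /sx E; rewrite compZ E scaler0 mode0l.
Qed.

Lemma Xc0l c w : Xc A 0 c w = 0.
Proof. by apply: (addrI (Xc A 0 c w)); rewrite -XcDl !addr0. Qed.

Lemma Xc0r u c : Xc A u c 0 = 0.
Proof. by apply: (addrI (Xc A u c 0)); rewrite -XcDr !addr0. Qed.

Lemma Xc_homog k u c w : comp A k u = u -> Xc A u c w = mode A u (k - c - 1) w.
Proof.
move=> ku; rewrite /Xc (@fsum1 _ _ k) ?ku // => n nk.
by rewrite (comp_homog _ ku) (negPf nk) mode0l.
Qed.

Lemma Xc_trunc v w : exists N : int, forall c, c < N -> Xc A v c w = 0.
Proof.
elim/homog_ind: v => [u u' [N uN] [N' uN']|k u ku].
  exists (Num.min N N') => c; rewrite lt_min => /andP[cN cN'].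
  by rewrite XcDl uN // uN' // addr0.
have [N uN] := mode_trunc A u w; exists (k - N) => c cN.
rewrite (Xc_homog _ _ ku) uN //; lia.
Qed.

Lemma iter_L0D (m : nat) u u' : iter m (L0 A) (u + u') = iter m (L0 A) u + iter m (L0 A) u'.
Proof. by elim: m => //= m ->; rewrite L0D. Qed.

Lemma iter_L0_homog k u (m : nat) : comp A k u = u ->
  iter m (L0 A) u = (k%:~R ^+ m) *: u.
Proof.
move=> ku; elim: m => [|m IH]; first by rewrite expr0 scale1r.
by rewrite iterS IH /L0 modeZr -/(L0 A u) (L0_homog ku) scalerA -exprSr.
Qed.

(** The bound is uniform in [m] because on a homogeneous vector the powers of L(0) act by
    scalars. *)
Lemma mode_iter_trunc u v : exists N : int, forall (m : nat) n, N <= n ->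
  mode A (iter m (L0 A) u) n v = 0.
Proof.
elim/homog_ind: u => [u u' [N uN] [N' uN']|k u ku].
  exists (Num.max N N') => m n; rewrite ge_max => /andP[cN cN'].
  by rewrite iter_L0D modeDl uN // uN' // addr0.
have [N uN] := mode_trunc A u v; exists N => m n nN.
by rewrite (iter_L0_homog _ ku) modeZl uN // scaler0.
Qed.

End VertexOperatorAlgebra.

(** * Zhu's operator at - y01 and the identity with binomial delta series *)

Section Zhu.
Variable C : numClosedFieldType.

Lemma minus_y01_tE : minus_y01_t C = scale1 (-1) (log1m C).
Proof. by apply/funext => i; rewrite /minus_y01_t /opp1 /scale1 mulN1r. Qed.

Lemma minus_y01_lt (i : int) : i < 1 -> minus_y01_t C i = 0.
Proof. by move=> i1; rewrite /minus_y01_t /opp1 log1m_lt ?oppr0. Qed.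

Lemma expm1_minus_y01 :
  add1 (exp1 (minus_y01_t C)) (opp1 (one1 C)) = tpow C 1 (-1).
Proof.
have -> : exp1 (minus_y01_t C) = tpow C 0 (-1).
  by rewrite minus_y01_tE -exp1_log intrN.
apply/funext => i; rewrite /add1 /opp1 /one1.
(* 1 / (1 - t) is t / (1 - t) shifted down by one degree, so both are read off the geometric
   series. *)
have -> : tpow C 0 (-1) i = tpow C 1 (-1) (i + 1).
  by rewrite /tpow subr0 addrK.
rewrite !tpow_geom; case: (ltgtP i 0) => i0.
- by rewrite (_ : (0 < i + 1) = false) ?subr0 //; lia.
- by rewrite (_ : (0 < i + 1) = true) ?subr0 //; lia.
- by rewrite i0 add0r subrr.
Qed.

(** Since y^m has order at least m, the terms with m >= M do not reach degree i. Taken at c the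
    weight of u, this resums the series of e^(yL(0)) u. *)
Lemma sum_pow1_exp (y g : ser1 C) (c : C) (q i : int) (M : nat) :
  (forall k, k < 1 -> y k = 0) -> (forall k, k < q -> g k = 0) -> i - q < M%:Z ->
  \sum_(m < M) mul1 (pow1 y m) g i / m`!%:R * c ^+ m
  = mul1 (exp1 (scale1 c y)) g i.
Proof.
move=> y0 g0 iM.
have sy0 k : k < 1 -> scale1 c y k = 0 by move=> k1; rewrite /scale1 y0 // mulr0.
rewrite (@mul1_ord _ _ _ 0 q M) ?subr0 //; last first.
  by move=> k k0; rewrite (@exp1_ord _ _ 0) ?big_ord0.
have eE (j : 'I_M) : exp1 (scale1 c y) (0 + j%:Z)
    = \sum_(m < M) pow1 (scale1 c y) m (0 + j%:Z) / m`!%:R.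
  by apply: exp1_ord => //; rewrite add0r ltz_nat.
under [RHS]eq_bigr => j _ do rewrite eE mulr_suml.
rewrite [RHS]exchange_big /=; apply: eq_bigr => m _.
rewrite (@mul1_ord _ _ _ 0 q M) ?subr0 //; last first.
  by move=> k k0; apply: pow1_lt => //; lia.
rewrite mulr_suml mulr_suml; apply: eq_bigr => j _; rewrite pow1_scale; ring.
Qed.

Variables (V : lmodType C) (A : VOA V).
Local Notation comp := Defs.comp.
Implicit Types (u v w : V).

(** The summand of [zhuY] once (e^y - 1)^(-n-1) has become t^(-n-1) (1 - t)^(n+1). *)
Definition zhu_term u v (i : int) (p : nat * int) : V :=
  (mul1 (pow1 (minus_y01_t C) p.1) (tpow C (- p.2 - 1) (p.2 + 1)) i / (p.1`!)%:R)
    *: mode A (iter p.1 (L0 A) u) p.2 v.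

Lemma zhuYE u v i : zhuY A u v (minus_y01_t C) i = fsum (zhu_term u v i).
Proof.
apply: eq_fsum => -[m n]; rewrite /zhu_term /= expm1_minus_y01 powz1_geom.
by rewrite (_ : - (- n - 1) = n + 1) //; lia.
Qed.

Lemma zhu_term_lt u v i (m : nat) (n : int) : i < m%:Z - n - 1 -> zhu_term u v i (m, n) = 0.
Proof.
move=> imn; rewrite /zhu_term /= (@mul1_ord _ _ _ m%:Z (- n - 1) 0).
- by rewrite big_ord0 mul0r scale0r.
- by move=> k km; apply: pow1_lt => //; exact: minus_y01_lt.
- exact: tpow_lt.
- lia.
Qed.

(** A nonzero term has n < N and m <= n + i + 1, as its order is at least m - n - 1. Hence both m
    and k = n + i + 1 lie in [0, M). *)
Lemma zhu_term_out u v i (N : int) (M : nat) :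
  (forall (m : nat) n, N <= n -> mode A (iter m (L0 A) u) n v = 0) ->
  N + i + 1 <= M%:Z ->
  forall p, p \notin [seq (m, k%:Z - i - 1) | m <- index_iota 0 M, k <- index_iota 0 M] ->
  zhu_term u v i p = 0.
Proof.
move=> uN NM [m n] pN; have [nN|Nn] := leP N n.
  by rewrite /zhu_term uN // scaler0.
have [imn|imn] := ltP i (m%:Z - n - 1); first exact: zhu_term_lt.
case/negP: pN; apply/allpairsP; exists (m, `|(n + i + 1)%R|%N) => /=.
rewrite !mem_index_iota; split; [lia|lia|congr (_, _); lia].
Qed.

Lemma zhu_term_fsupp u v i : fsupp (zhu_term u v i).
Proof.
have [N uN] := mode_iter_trunc A u v.
have NM : N + i + 1 <= `|(N + i + 1)%R|%N%:Z by lia.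
by eexists; exact: zhu_term_out uN NM.
Qed.

Lemma zhuYDl u u' v i : zhuY A (u + u') v (minus_y01_t C) i
  = zhuY A u v (minus_y01_t C) i + zhuY A u' v (minus_y01_t C) i.
Proof.
rewrite !zhuYE -fsumD; try exact: zhu_term_fsupp.
by apply: eq_fsum => p; rewrite /zhu_term iter_L0D modeDl scalerDr.
Qed.

Lemma zhuYDr u v v' i : zhuY A u (v + v') (minus_y01_t C) i
  = zhuY A u v (minus_y01_t C) i + zhuY A u v' (minus_y01_t C) i.
Proof.
rewrite !zhuYE -fsumD; try exact: zhu_term_fsupp.
by apply: eq_fsum => p; rewrite /zhu_term modeDr scalerDr.
Qed.

Lemma zhuY_trunc u v : exists N : int, forall i, i < N ->
  zhuY A u v (minus_y01_t C) i = 0.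
Proof.
have [N uN] := mode_iter_trunc A u v; exists (- N) => i iN; rewrite zhuYE.
apply: fsum0 => p; apply: (@zhu_term_out _ _ _ N 0) => //; lia.
Qed.

(* For [u] of weight [k], [Y[u, -y01] v] is
   [sum_n t^(-n-1) (1-t)^(n+1-k) u_n v] with [t = x0/x1]. *)
Lemma zhuY_homog (k : int) u v (i : int) (M : nat) : comp A k u = u ->
  (forall n, M%:Z <= n + i + 1 -> mode A u n v = 0) ->
  zhuY A u v (minus_y01_t C) i
  = \sum_(j < M) sbinz C (j%:Z - i - k) j *: mode A u (j%:Z - i - 1) v.
Proof.
move=> ku uM; rewrite zhuYE.
rewrite (@fsum_seq _ _ [seq (m, k%:Z - i - 1) | m <- index_iota 0 M,
                                                k <- index_iota 0 M]).
- rewrite big_allpairs_dep big_mkord.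
  under eq_bigr => m _ do rewrite big_mkord.
  rewrite exchange_big /=; apply: eq_bigr => -[j /= jM] _.
  rewrite /zhu_term /=.
  under eq_bigr => m _ do rewrite (iter_L0_homog _ ku) modeZl scalerA.
  rewrite -scaler_suml; congr (_ *: _).
  (* For n = j - i - 1 the second factor starts in degree i - j, so the bound required of [M] is
     just j < M. *)
  rewrite (@sum_pow1_exp _ _ _ (- (j%:Z - i - 1) - 1)) //; [|exact: minus_y01_lt|exact: tpow_lt|lia].
  have -> : scale1 k%:~R (minus_y01_t C) = scale1 (- k)%:~R (log1m C).
    by apply/funext => l; rewrite /scale1 /minus_y01_t /opp1 intrN mulrN mulNr.
  rewrite exp1_log mul1_tpow (_ : tpow _ _ _ _ = tpow C (i - j%:Z) (j%:Z - i - k) (i - j%:Z + j%:Z)).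
    by rewrite tpow_nat.
  by congr (tpow _ _ _ _); lia.
- by rewrite allpairs_uniq ?iota_uniq // => -[m n] [m' n'] _ _ /= [-> E]; congr (_, _); lia.
- apply: (@zhu_term_out _ _ _ (M%:Z - i - 1)); last lia.
  move=> m n Mn; rewrite (iter_L0_homog _ ku) modeZl uM ?scaler0 //; lia.
Qed.

(** Both sides are first treated with the binomial delta series in which the Jacobi identity is
    stated; the exponential forms return only in the theorem. *)
Definition zhu_lhs u v w (e : T3) : V :=
  vmul3 (smul3 (mono3 C (tr (-1) 0 0))
               (delta_bin (tr 0 1 0) (-1) (tr 0 0 1) 1 (tr 1 0 0)))
        (XX A u v w) e
  - vmul3 (smul3 (mono3 C (tr (-1) 0 0))
                 (delta_bin (tr 0 0 1) (-1) (tr 0 1 0) (-1) (tr 1 0 0)))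
          (XXrev A u v w) e.

Definition zhu_rhs u v w (e : T3) : V :=
  vmul3 (smul3 (mono3 C (tr 0 0 (-1)))
               (delta_bin (tr 0 1 0) (-1) (tr 1 0 0) 1 (tr 0 0 1)))
        (XW A (zhuY A u v (minus_y01_t C)) w) e.

Lemma zhu_lhsE u v w a b c : zhu_lhs u v w (tr a b c) =
  fsum (fun k : nat => sbinz C (- a - 1) k *:
      Xc A u (b + a + 1 + k%:Z) (Xc A v (c - k%:Z) w))
  - fsum (fun k : nat => (sbinz C (- a - 1) k * (-1) ^ (a + 1)) *:
      Xc A v (c + a + 1 + k%:Z) (Xc A u (b - k%:Z) w)).
Proof.
rewrite /zhu_lhs vmul3_delta1 ?vmul3_delta2 //.
  by move=> a' b' c' a0; rewrite /XXrev /tr (negPf a0).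
by move=> a' b' c' a0; rewrite /XX /tr (negPf a0).
Qed.

Lemma zhu_rhsE u v w a b c : zhu_rhs u v w (tr a b c) =
  fsum (fun k : nat => sbinz C (a + b) k *:
      Xc A (zhuY A u v (minus_y01_t C) (a - k%:Z)) (c + (a + b) + 1) w).
Proof.
rewrite /zhu_rhs (@vmul3_delta3 _ _ _ (fun=> a + b)) => [|n k nk].
  apply: eq_fsum => k; rewrite /XW /tr (_ : _ == _) //; lia.
rewrite /XW /tr ifF //; lia.
Qed.

Lemma XcXc_fsupp u v w (f : nat -> C) (b c : int) :
  fsupp (fun k : nat => f k *: Xc A u (b + k%:Z) (Xc A v (c - k%:Z) w)).
Proof.
have [N vN] := Xc_trunc A v w; apply: (@fsupp_nat _ `|c - N|.+1) => k kN.
by rewrite vN ?Xc0r ?scaler0 //; lia.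
Qed.

Lemma Xc_zhuY_fsupp u v w (f : nat -> C) (a c : int) :
  fsupp (fun k : nat => f k *: Xc A (zhuY A u v (minus_y01_t C) (a - k%:Z)) c w).
Proof.
have [N vN] := zhuY_trunc u v; apply: (@fsupp_nat _ `|a - N|.+1) => k kN.
by rewrite vN ?Xc0l ?scaler0 //; lia.
Qed.

Lemma zhu_lhsDl u u' v w e : zhu_lhs (u + u') v w e = zhu_lhs u v w e + zhu_lhs u' v w e.
Proof.
case: e => -[a b] c; rewrite -/(tr a b c) !zhu_lhsE addrACA -(opprD (fsum _)).
rewrite -!fsumD; try exact: XcXc_fsupp.
by congr (_ - _); apply: eq_fsum => k; rewrite XcDl ?XcDr scalerDr.
Qed.

Lemma zhu_lhsDr u v v' w e : zhu_lhs u (v + v') w e = zhu_lhs u v w e + zhu_lhs u v' w e.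
Proof.
case: e => -[a b] c; rewrite -/(tr a b c) !zhu_lhsE addrACA -(opprD (fsum _)).
rewrite -!fsumD; try exact: XcXc_fsupp.
by congr (_ - _); apply: eq_fsum => k; rewrite XcDl ?XcDr scalerDr.
Qed.

Lemma zhu_rhsDl u u' v w e : zhu_rhs (u + u') v w e = zhu_rhs u v w e + zhu_rhs u' v w e.
Proof.
case: e => -[a b] c; rewrite -/(tr a b c) !zhu_rhsE -fsumD; try exact: Xc_zhuY_fsupp.
by apply: eq_fsum => k; rewrite zhuYDl XcDl scalerDr.
Qed.

Lemma zhu_rhsDr u v v' w e : zhu_rhs u (v + v') w e = zhu_rhs u v w e + zhu_rhs u v' w e.
Proof.
case: e => -[a b] c; rewrite -/(tr a b c) !zhu_rhsE -fsumD; try exact: Xc_zhuY_fsupp.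
by apply: eq_fsum => k; rewrite zhuYDr XcDl scalerDr.
Qed.

Lemma XX_shift (k l : int) u v w : comp A k u = u -> comp A l v = v ->
  XX A u v w = fun d => YY (mode A) u v w (d - tr 0 k l).
Proof.
move=> ku lv; apply/funext => -[[a b] c] /=; rewrite subr0.
rewrite (Xc_homog _ _ ku) (Xc_homog _ _ lv).
by case: eqP => // _; congr (mode A u _ (mode A v _ w)); lia.
Qed.

Lemma XXrev_shift (k l : int) u v w : comp A k u = u -> comp A l v = v ->
  XXrev A u v w = fun d => YYrev (mode A) u v w (d - tr 0 k l).
Proof.
move=> ku lv; apply/funext => -[[a b] c] /=; rewrite subr0.
rewrite (Xc_homog _ _ ku) (Xc_homog _ _ lv).
by case: eqP => // _; congr (mode A v _ (mode A u _ w)); lia.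
Qed.

Lemma zhu_jacobi_homog (k l : int) u v w e : comp A k u = u -> comp A l v = v ->
  zhu_lhs u v w e = zhu_rhs u v w e.
Proof.
(* The factor x1^k x2^l leaves the products, so the Jacobi identity is read at the exponent
   [e - tr 0 k l]. *)
move=> ku lv; rewrite /zhu_lhs (XX_shift _ ku lv) (XXrev_shift _ ku lv) !vmul3_shift.
have := congr1 (fun F => F (e - tr 0 k l)) (jacobi A u v w) => /= ->.
case: e => -[a b] c; rewrite -/(tr a b c) zhu_rhsE trN trD vmul3_YYit.
have [N uN] := mode_trunc A u v; pose M := `|(N + a + 1)%R|%N.
have uM n : M%:Z <= n + a + 1 -> mode A u n v = 0 by move=> H; apply: uN; lia.
(* [T n] is the vector common to both sides; on the right it depends only on the total n = i + j of
   the two expansion indices. *)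
pose T (n : nat) := mode A (mode A u (n%:Z - a - 1) v) (k + l - n%:Z - 2 - b - c) w.
have T0 n : (M <= n)%N -> T n = 0.
  by move=> Mn; rewrite /T uM ?mode0l //; lia.
rewrite (@fsum_ord _ M); last first.
  by move=> n Mn; rewrite uM ?mode0l ?scaler0 //; lia.
(* The outer mode index is determined by the weight of u_n v. *)
have XcE (i : nat) : Xc A (zhuY A u v (minus_y01_t C) (a - i%:Z)) (c + (a + b) + 1) w
    = \sum_(j < M) sbinz C (i%:Z + j%:Z - a - k) j *: T (i + j)%N.
  rewrite (@zhuY_homog k _ _ _ M) //; last by move=> n H; apply: uM; lia.
  elim/big_ind2: _ => [|x x' y y' <- <-|j _]; rewrite ?Xc0l ?XcDl // XcZl.
  rewrite (Xc_homog _ _ (mode_wt _ ku lv)) /T.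
  by congr (sbinz C _ _ *: mode A (mode A u _ v) _ w); lia.
rewrite [RHS](@fsum_ord _ M); last first.
  move=> n Mn; rewrite XcE big1 ?scaler0 // => j _.
  by rewrite T0 ?scaler0 // (leq_trans Mn) ?leq_addr.
under [RHS]eq_bigr => i _ do rewrite XcE scaler_sumr.
rewrite (@sum_antidiag _ M (fun i j =>
  sbinz C (a + b) i *: (sbinz C (i%:Z + j%:Z - a - k) j *: T (i + j)%N))); last first.
  by move=> i j ij; rewrite T0 // !scaler0.
apply: eq_bigr => -[n /= nM] _.
rewrite (eq_bigr (fun i : 'I_n.+1 => (sbinz C (a + b) i *
    sbinz C (i%:Z + (n - i)%N%:Z - a - k) (n - i)) *: T n)); last first.
  by move=> [i /=]; rewrite ltnS => iN _; rewrite subnKC // scalerA.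
rewrite -scaler_suml; congr (_ *: _); last first.
  by rewrite /T; congr (mode A (mode A u _ v) _ w); lia.
(* The exponents a + b from the delta series and n - a - k from Zhu's operator add up to the
   exponent in the Jacobi identity. *)
rewrite (_ : b - k + n%:Z = a + b + (n%:Z - a - k)); last lia.
rewrite -sbinz_Vandermonde; apply: eq_bigr => -[i /=]; rewrite ltnS => iN _.
by congr (_ * sbinz C _ _); lia.
Qed.

Lemma zhu_jacobi u v w e : zhu_lhs u v w e = zhu_rhs u v w e.
Proof.
move: v; elim/(@homog_ind _ _ A): u => [u u' IH IH'|k u ku] v.
  by rewrite zhu_lhsDl zhu_rhsDl IH IH'.
elim/(@homog_ind _ _ A): v => [v v' IH IH'|l v lv].
  by rewrite zhu_lhsDr zhu_rhsDr IH IH'.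
exact: zhu_jacobi_homog ku lv.
Qed.

End Zhu.

Theorem theorem4p2 (C : numClosedFieldType) (V : lmodType C) (A : VOA V)
    (u v w : V) :
  (fun e : T3 =>
      vmul3 (smul3 (mono3 C (tr (-1) 0 0))
                   (delta_exp 1 (y21 C) (tr (-1) 1 0)))
            (XX A u v w) e
    - vmul3 (smul3 (mono3 C (tr (-1) 0 0))
                   (delta_exp (-1) (y12 C) (tr (-1) 0 1)))
            (XXrev A u v w) e)
  = vmul3 (smul3 (mono3 C (tr 0 0 (-1)))
                 (delta_exp 1 (y01 C) (tr 0 1 (-1))))
          (XW A (zhuY A u v (minus_y01_t C)) w).
Proof.
have d1 := delta_exp_bin (1 : C) expo1_inj; rewrite invr1 in d1.
have d2 := delta_exp_bin (-1 : C) expo2_inj; rewrite invrN1 in d2.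
have d3 := delta_exp_bin (1 : C) expo3_inj; rewrite invr1 in d3.
(* The directions of [y21], [y12] and [y01] are the differences [be - al] computed out, so the
   patterns match by conversion. *)
rewrite [delta_exp 1 (y21 C) _]d1 [delta_exp (-1) _ _]d2 [delta_exp 1 (y01 C) _]d3.
by apply/funext => e; exact: zhu_jacobi.
Qed.
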